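(* Let $G$ be a finite directed multigraph and let $q,s:V(G)\to\mathbb{Z}_{\ge 0}$ be a quota and a start portfolio. Then, for any queue-extraction rule, generic at-most quota search in $G$ with start portfolio $s$ achieves the quotas $q$ if and only if $(G,q,s)$ is connected and has enough arrows.
   Context: A directed multigraph $G=(V,E,i,t)$ has a vertex set $V=V(G)$, an edge set $E$, and maps $i,t:E\to V$ giving the initial and terminal vertex of each edge; loops and multiple (distinguishable) edges are allowed. Let $m_{vw}$ be the number of edges from $v$ to $w$. Generic (at-most) quota search in $G$ with start portfolio $s$ and quotas $q$ is the following procedure. It maintains a queue $Q$ (a finite collection of items, each item having an endpoint in $V(G)$), a search forest $F$, and current remaining quotas, which initially equal $q$. Initially $F$ is empty and $Q$ contains, for each $v\in V(G)$, exactly $s(v)$ sentinel items with endpoint $v$ (potential roots of trees of $F$). While $Q$ is nonempty: extract one item $\tilde e$ from $Q$ (which item is extracted is decided by an arbitrary extraction rule), and let $v$ be its endpoint. If the current remaining quota at $v$ is positive, then add $\tilde e$ to $F$, decrement the remaining quota at $v$ by one, and, for each edge $e'$ of $G$ with $i(e')=v$, insert into $Q$ a new item lying over $e'$, with endpoint $t(e')$ and predecessor $\tilde e$; if the current remaining quota at $v$ is $0$, discard $\tilde e$. The search achieves the quotas $q$ if all remaining quotas are $0$ upon termination. $(G,q,s)$ is connected if for every vertex $v$ with $q(v)>0$ there exist a vertex $u$ with $s(u)>0$ and a directed path (possibly of length zero) from $u$ to $v$ in the subgraph of $G$ induced by $\{x\in V(G): q(x)>0\}$. $(G,q,s)$ has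 enough arrows if $s(w)+\sum_{v} q(v)\,m_{vw}\ge q(w)$ for every $w\in V(G)$. *)

(* Defs.v *)
From HB Require Import structures.
From mathcomp Require Import all_boot.

Set Implicit Arguments.
Unset Strict Implicit.
Unset Printing Implicit Defensive.

Record multigraph : Type := Multigraph {
  vertex :> finType;
  edge : finType;
  initial : edge -> vertex;
  terminal : edge -> vertex
}.

(* Number of edges from v to w. *)
Definition mult (G : multigraph) (v w : G) : nat :=
  #|[set e : edge G | (initial e == v) && (terminal e == w)]|.

(* Queue items.  [Sentinel v k] is the k-th sentinel at v, and [Over e p] lies  *)
(* over the edge e and has predecessor p.  An item is extracted at most once,   *)
(* so the items occurring in a search are pairwise distinct.                    *)
Inductive item (G : multigraph) : Type :=
  | Sentinel of G & nat
  | Over of edge G & item G.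

Section ItemEq.
Variable G : multigraph.

Fixpoint item_code (x : item G) : G * nat * seq (edge G) :=
  match x with
  | Sentinel v k => (v, k, [::])
  | Over e p => let c := item_code p in (c.1, e :: c.2)
  end.

Definition item_decode (c : G * nat * seq (edge G)) : item G :=
  foldr (@Over G) (Sentinel c.1.1 c.1.2) c.2.

Lemma item_codeK : cancel item_code item_decode.
Proof. by elim=> [v k|e p IHp] //; rewrite -[in RHS]IHp. Qed.

HB.instance Definition _ := Equality.copy (item G) (can_type item_codeK).
End ItemEq.

Definition endpoint (G : multigraph) (x : item G) : G :=
  match x with
  | Sentinel v _ => v
  | Over e _ => terminal e
  end.

(* The forest is given by its nodes: items carry their predecessors.            *)
Record state (G : multigraph) : Type := State {
  queue : seq (item G);
  forest : seq (item G);
  remaining : G -> nat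
}.

Definition initial_state (G : multigraph) (q s : G -> nat) : state G :=
  {| queue := [seq Sentinel v k | v <- enum G, k <- iota 0 (s v)];
     forest := [::];
     remaining := q |}.

Definition process (G : multigraph) (x : item G) (st : state G) : state G :=
  let v := endpoint x in
  let Q := rem x (queue st) in
  if 0 < remaining st v then
    {| queue := Q ++ [seq Over e x | e <- enum (edge G) & initial e == v];
       forest := rcons (forest st) x;
       remaining := [eta remaining st with v |-> (remaining st v).-1] |}
  else
    {| queue := Q; forest := forest st; remaining := remaining st |}.

(* The choice may depend on the list of all earlier states (oldest first) as    *)
(* well as on the current one; the value is None exactly on an empty queue.     *)
Record extraction_rule (G : multigraph) : Type := ExtractionRule {
  extract :> seq (state G) -> state G -> option (item G);
  extractP : forall past st,
    if extract past st is Some x then x \in queue st else queue st == [::]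
}.

(* Earlier states and current state after n iterations; the search stays put    *)
(* once its queue is empty.                                                     *)
Fixpoint search (G : multigraph) (q s : G -> nat) (rule : extraction_rule G)
    (n : nat) : seq (state G) * state G :=
  if n is n'.+1 then
    let: (past, st) := search q s rule n' in
    (rcons past st, if rule past st is Some x then process x st else st)
  else ([::], initial_state q s).

Definition achieves (G : multigraph) (q s : G -> nat)
    (rule : extraction_rule G) : Prop :=
  exists n, let st := (search q s rule n).2 in
    queue st = [::] /\ forall v, remaining st v = 0.

Definition arrow (G : multigraph) : rel G := fun x y => 0 < mult x y.

(* The path visits the vertices u :: p, all of them in the subgraph induced by  *)
(* the vertices of positive quota.                                              *)
Definition connected (G : multigraph) (q s : G -> nat) : Prop :=
  forall v : G, 0 < q v ->
  exists (u : G) (p : seq G),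
    [/\ 0 < s u, path (@arrow G) u p, last u p = v
      & all (fun x => 0 < q x) (u :: p)].

Definition enough_arrows (G : multigraph) (q s : G -> nat) : Prop :=
  forall w : G, q w <= s w + \sum_(v : G) q v * mult v w.

(* Main.v *)
Require Import Defs.
From mathcomp Require Import all_boot zify.

Set Implicit Arguments.
Unset Strict Implicit.
Unset Printing Implicit Defensive.

(** Let [a v] be the number of items accepted at [v], so that [q v - a v] is the
    quota left there.  Two invariants govern the search.

    The first is bookkeeping ([arrivals]).  Every item ever inserted at [w] is a
    sentinel or lies over an edge leaving an accepted item, so
    [s w + \sum_v a v * mult v w] items have been inserted at [w].  Each of them is
    waiting, accepted or discarded, and nothing is discarded while quota is left.

    The second expresses that the forest is well founded ([entrance]).  The first
    item ever inserted with an endpoint in a set [M] of vertices is a sentinel, or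
    its predecessor was accepted outside [M].

    The search stops, because accepting an item costs one unit of quota and inserts
    at most [#|edge G|] items.

    If all quotas are achieved, then [a = q].  The bookkeeping then says that there
    are enough arrows.  Applied to the set of vertices of positive quota that cannot
    be reached, the second invariant shows that this set is empty.

    Conversely, suppose the search stops with quota left on a nonempty set [R],
    though the data are connected and have enough arrows.  For [w] in [R] nothing was
    discarded, so [a w = s w + \sum_v a v * mult v w].  Two consequences follow.
    Acceptance spreads along the paths of the connectivity hypothesis, so [a] is
    positive wherever [q] is.  Comparison with the inequality for [q] gives
    [q w - a w <= \sum_v (q v - a v) * mult v w], so [w] has an arrow from some [v] in
    [R], and [a v <= a w].  Let [M] be the set where [a] takes its minimum over [R].
    For [w] in [M] the arrow from [v] alone already accounts for all of [a w], and
    [v] is in [M].  Hence no sentinel and no arrow from an accepted item outside [M]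
    ever led into [M], which contradicts the second invariant. *)

(** * Quantities attached to a state *)

Section Search.
Variables (G : multigraph) (q s : G -> nat).
Implicit Types (st : state G) (x : item G) (v w : G).

Definition accepted st v := q v - remaining st v.

Definition waiting st w := count (fun x => endpoint x == w) (queue st).

Definition inflow st w := \sum_v accepted st v * mult v w.

Definition within_quotas st := forall v, remaining st v <= q v.

(** The rule may only choose a member of the queue, so a property kept by processing
    an arbitrary member holds at all times, whatever the rule. *)
Lemma search_ind (rule : extraction_rule G) (P : state G -> Prop) :
  P (initial_state q s) ->
  (forall x st, x \in queue st -> P st -> P (process x st)) ->
  forall n, P (search q s rule n).2.
Proof.
move=> P0 PS; elim=> [//|n IHn] /=.
case: (search q s rule n) IHn => past st /= Pst.
by have := extractP rule past st; case: (rule past st) => // x xQ; apply: PS.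
Qed.

Lemma count_endpoint_over x v w :
  count (fun y => endpoint y == w)
    [seq Over e x | e <- enum (edge G) & initial e == v] = mult v w.
Proof.
rewrite count_map count_filter /mult cardE size_filter -enumT.
by apply: eq_count => e /=; rewrite inE andbC.
Qed.

Lemma waiting_process x st w : x \in queue st ->
  waiting (process x st) w + (w == endpoint x) =
  waiting st w + (0 < remaining st (endpoint x)) * mult (endpoint x) w.
Proof.
move=> xQ; rewrite /waiting /process (eq_sym w).
have count1 : (endpoint x == w) <= count (fun y => endpoint y == w) (queue st).
  by case: eqP => // xw; rewrite -has_count; apply/hasP; exists x => //; apply/eqP.
by case: ifP => _ /=; rewrite ?count_cat ?count_endpoint_over count_rem xQ /=; lia.
Qed.

Lemma remaining_process x st w :
  remaining (process x st) w = remaining st w - (w == endpoint x).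
Proof.
rewrite /process; case: ifP => /= [_|]; case: eqP => [->|_]; lia.
Qed.

Lemma within_quotas_process x st :
  within_quotas st -> within_quotas (process x st).
Proof. by move=> qst v; rewrite remaining_process (leq_trans (leq_subr _ _)). Qed.

Lemma accepted_process x st w : within_quotas st ->
  accepted (process x st) w =
  accepted st w + (0 < remaining st (endpoint x)) * (w == endpoint x).
Proof.
move=> /(_ w); rewrite /accepted remaining_process.
case: eqP => [->|_]; lia.
Qed.

Lemma inflow_process x st w : within_quotas st ->
  inflow (process x st) w =
  inflow st w + (0 < remaining st (endpoint x)) * mult (endpoint x) w.
Proof.
move=> qst; rewrite /inflow.
under eq_bigr => v _ do rewrite accepted_process // mulnDl.
rewrite big_split /=; congr (_ + _).
rewrite (bigD1 (endpoint x)) //= eqxx muln1 big1 ?addn0 // => v /negPf ->.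
by rewrite muln0.
Qed.

Lemma waiting_initial w : waiting (initial_state q s) w = s w.
Proof.
rewrite /waiting /= count_flatten sumnE !big_map.
under eq_bigr => v _ do rewrite count_map.
rewrite -enumT big_enum /= (bigD1 w) //= big1 => [|v vw].
  rewrite addn0 -[RHS](size_iota 0); apply/eqP; rewrite -all_count.
  by apply/allP => k _ /=.
by apply/eqP; rewrite -leqn0 leqNgt -has_count; apply/hasPn => k _ /=.
Qed.

Lemma mem_waiting x st : x \in queue st -> 0 < waiting st (endpoint x).
Proof. by move=> xQ; rewrite -has_count; apply/hasP; exists x. Qed.

(** * The two invariants *)

Definition arrivals st := forall w,
  waiting st w + accepted st w <= s w + inflow st w
    /\ (0 < remaining st w -> waiting st w + accepted st w = s w + inflow st w).

Definition entrance st := forall (M : pred G) v, M v ->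
  0 < waiting st v + accepted st v ->
  exists2 w, M w & 0 < s w \/ exists u, [/\ ~~ M u, 0 < accepted st u & arrow u w].

Definition invariant st := [/\ within_quotas st, arrivals st & entrance st].

Lemma accepted_initial v : accepted (initial_state q s) v = 0.
Proof. by rewrite /accepted subnn. Qed.

Lemma invariant_initial : invariant (initial_state q s).
Proof.
split=> [v //|w|M v Mv].
  rewrite waiting_initial accepted_initial /inflow big1 // => v _.
  by rewrite accepted_initial.
by rewrite waiting_initial accepted_initial addn0 => sv; exists v => //; left.
Qed.

Lemma arrivals_process x st : x \in queue st ->
  within_quotas st -> arrivals st -> arrivals (process x st).
Proof.
move=> xQ qst arr w; have [le_w eq_w] := arr w.
have := waiting_process w xQ.
rewrite inflow_process // accepted_process // remaining_process.
by case: (eqVneq w (endpoint x)) => [<-|_]; case: posnP => /=; lia.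
Qed.

(** Only two ways of getting into [M] are new: the item just accepted, which was
    waiting before, and the items inserted by it, which matter only if it lies
    outside [M] and then provide the entrance themselves. *)
Lemma entrance_process x st : x \in queue st ->
  within_quotas st -> entrance st -> entrance (process x st).
Proof.
move=> xQ qst ent M v Mv new.
have mono u : accepted st u <= accepted (process x st) u.
  by rewrite accepted_process // leq_addr.
have old w : M w -> 0 < waiting st w + accepted st w ->
    exists2 w, M w &
      0 < s w \/ exists u, [/\ ~~ M u, 0 < accepted (process x st) u & arrow u w].
  move=> Mw /(ent M w Mw) [w' Mw' [sw'|[u [Mu au uw']]]]; exists w' => //.
    by left.
  by right; exists u; split=> //; apply: leq_trans (mono u).
have [Mx|Mx] := boolP (M (endpoint x)).
  by apply: (old _ Mx); rewrite addn_gt0 mem_waiting.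
have [] := posnP (waiting st v + accepted st v); last exact: old.
have vx : (v == endpoint x) = false by apply: contraNF Mx => /eqP <-.
have := waiting_process v xQ; have := accepted_process x v qst.
rewrite vx => eq_a eq_w old0.
have [x_acc xv] : 0 < remaining st (endpoint x) /\ 0 < mult (endpoint x) v.
  by move: eq_a eq_w new old0; case: posnP => /=; lia.
exists v => //; right; exists (endpoint x); split=> //.
by rewrite accepted_process // x_acc eqxx addn1.
Qed.

Lemma invariant_search (rule : extraction_rule G) n :
  invariant (search q s rule n).2.
Proof.
apply: search_ind => [|x st xQ [qst arr ent]]; first exact: invariant_initial.
by split; [exact: within_quotas_process | exact: arrivals_process
          | exact: entrance_process].
Qed.

(** * Termination *)

(** The weight of a unit of quota exceeds by one the number of items whose insertion
    it may pay for. *)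
Definition fuel st :=
  (\sum_v remaining st v) * #|edge G|.+1 + size (queue st).

Lemma fuel_process x st : x \in queue st -> fuel (process x st) < fuel st.
Proof.
move=> xQ; have size_Q := size_rem xQ.
have Q_gt0 : 0 < size (queue st) by case: (queue st) xQ.
rewrite /fuel (bigD1 (endpoint x)) //= [in X in _ < X](bigD1 (endpoint x)) //=.
rewrite remaining_process eqxx.
under eq_bigr => v /negPf vx do rewrite remaining_process vx subn0.
rewrite /process; case: posnP => /= [->|].
  by rewrite sub0n ltn_add2l size_Q prednK.
have := count_size (fun e : edge G => initial e == endpoint x) (enum (edge G)).
rewrite size_cat size_map size_filter size_Q -cardE.
move: (count _ _) (remaining _ _) (\sum_(_ | _) _) #|edge G| (size _) Q_gt0.
by move=> c r rest E k; nia.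
Qed.

Lemma search_terminates (rule : extraction_rule G) :
  exists n, queue (search q s rule n).2 = [::].
Proof.
have burn n : queue (search q s rule n).2 = [::] \/
    fuel (search q s rule n).2 + n <= fuel (initial_state q s).
  elim: n => [|n IHn] /=; first by right; rewrite addn0.
  case: (search q s rule n) IHn => past st /= IHn.
  have := extractP rule past st; case: (rule past st) => [x xQ|/eqP]; last by left.
  case: IHn => [Q0|]; first by rewrite Q0 in xQ.
  by have := fuel_process xQ; right; lia.
by case: (burn (fuel (initial_state q s)).+1) => [|]; [eexists; eassumption | lia].
Qed.

(** * Final states *)

Section Final.
Variable st : state G.
Hypotheses (st_inv : invariant st) (st_end : queue st = [::]).

Lemma waiting_final w : waiting st w = 0.
Proof. by rewrite /waiting st_end. Qed.

Lemma accepted_final w :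
  0 < remaining st w -> accepted st w = s w + inflow st w.
Proof.
by move=> rw; case: st_inv => _ /(_ w) [_ /(_ rw)]; rewrite waiting_final.
Qed.

Lemma accepted_arrow v w : accepted st v * mult v w <= inflow st w.
Proof. by rewrite /inflow (bigD1 v) //= leq_addr. Qed.

Lemma achieved_enough_arrows :
  (forall v, remaining st v = 0) -> enough_arrows q s.
Proof.
move=> r0 w; case: st_inv => _ /(_ w) [+ _] _.
rewrite waiting_final /inflow /accepted r0 subn0.
by under eq_bigr => v _ do rewrite r0 subn0.
Qed.

(** The entrance invariant for the set of unreached vertices of positive quota would
    lead into it from a sentinel or from a reached vertex, hence that set is empty.
    Reachability is phrased with [connect] because [entrance] is about boolean sets. *)
Lemma achieved_connected :
  (forall v, remaining st v = 0) -> connected q s.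
Proof.
move=> r0 v qv; have aE u : accepted st u = q u by rewrite /accepted r0 subn0.
pose e := [rel x y : G | (0 < q y) && arrow x y].
pose reached w := [exists u, [&& 0 < s u, 0 < q u & connect e u w]].
have [/existsP[u /and3P[su qu /connectP[p ep ->]]]|unreached] := boolP (reached v).
  exists u, p; split=> //; first by apply: sub_path ep => x y /andP[].
  rewrite /= qu /=; elim: p u {su qu} ep => //= w p IHp u.
  by case/andP=> /andP[-> _] /IHp.
case: st_inv => _ _ /(_ [pred w | (0 < q w) && ~~ reached w] v).
case=> [||w /andP[qw /existsP nw]]; rewrite /= ?qv ?aE ?addn_gt0 ?qv ?orbT //.
case=> [sw|[u [Mu au uw]]]; case: nw.
  by exists w; rewrite sw qw connect0.
move: Mu; rewrite -aE au /= negbK => /existsP[u0 /and3P[su0 qu0 u0u]].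
exists u0; rewrite su0 qu0 (connect_trans u0u) //.
by apply: connect1; rewrite /= qw.
Qed.

(** Either the quota is used up, and it was positive, or everything that was inserted
    at [w] has been accepted. *)
Lemma accepted_gt0 w : 0 < q w -> 0 < s w + inflow st w -> 0 < accepted st w.
Proof.
have [r0 qw _|rw _] := posnP (remaining st w); last by rewrite accepted_final.
by rewrite /accepted r0 subn0.
Qed.

Lemma connected_accepted_gt0 v : connected q s -> 0 < q v -> 0 < accepted st v.
Proof.
move=> conn /conn [u [p [su up <-]]] /= /andP[qu].
have : 0 < accepted st u by rewrite accepted_gt0 // addn_gt0 su.
elim: p u {su qu} up => //= w p IHp u /andP[uw wp] au /andP[qw qp].
apply: IHp => //; rewrite accepted_gt0 // addn_gt0 orbC.
by rewrite (leq_trans _ (accepted_arrow u w)) // muln_gt0 au.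
Qed.

(** Subtracting the balance of accepted items from the inequality for [q] leaves an
    inequality for the remaining quotas. *)
Lemma remaining_predecessor w : enough_arrows q s -> 0 < remaining st w ->
  exists2 v, 0 < remaining st v & arrow v w.
Proof.
move=> enough rw; have [qst _ _] := st_inv.
have : \sum_v remaining st v * mult v w != 0.
  have := enough w; have := accepted_final rw; have := qst w.
  suff -> : \sum_v q v * mult v w = inflow st w + \sum_v remaining st v * mult v w.
    by rewrite /accepted; lia.
  by rewrite -big_split; apply: eq_bigr => v _ /=; rewrite -mulnDl subnK.
rewrite sum_nat_eq0 negb_forall => /existsP[v /=].
by rewrite -lt0n muln_gt0 => /andP[rv vw]; exists v.
Qed.

(** [m] minimizes the number of accepted items over the vertices with quota left; the
    entrance to the level set [M] of [m] contradicts the balance at the vertex [w]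
    where it leads in, since the arrow from [p] alone already saturates [w]. *)
Lemma final_remaining0 v :
  connected q s -> enough_arrows q s -> remaining st v = 0.
Proof.
move=> conn enough; have [//|rv] := posnP (remaining st v).
have [qst _ ent] := st_inv.
case: (@arg_minnP G v (fun w => 0 < remaining st w) (accepted st) rv) => m rm m_min.
pose M := [pred w | (0 < remaining st w) && (accepted st w == accepted st m)].
have am : 0 < accepted st m.
  by apply: connected_accepted_gt0 => //; apply: leq_trans (qst m).
have [|| w /andP[rw /eqP aw] into] := ent M m.
- by rewrite /= rm eqxx.
- by rewrite addn_gt0 am orbT.
have [p rp pw] := remaining_predecessor enough rw.
have le_mp := m_min p rp; have in_w := accepted_final rw.
have via_p : accepted st p <= accepted st p * mult p w by rewrite leq_pmulr.
case: into => [sw|[u [Mu au uw]]].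
  by have := accepted_arrow p w; lia.
have via_u : 0 < accepted st u * mult u w by rewrite muln_gt0 au.
have [up|up] := eqVneq u p.
  (* The entering arrow is the arrow from [p], so [p] lies in [M] by minimality. *)
  subst u; move: Mu; rewrite /= rp /= => /eqP [].
  by have := accepted_arrow p w; lia.
have : inflow st w >= accepted st p * mult p w + accepted st u * mult u w.
  by rewrite /inflow (bigD1 p) //= (bigD1 u) //= addnA leq_addr.
by lia.
Qed.

End Final.
End Search.

Theorem theorem2 (G : multigraph) (q s : G -> nat) (rule : extraction_rule G) :
  achieves q s rule <-> connected q s /\ enough_arrows q s.
Proof.
split=> [[n [Q0 r0]]|[conn enough]].
  have inv := invariant_search q s rule n.
  by split; [exact: achieved_connected inv r0
            | exact: achieved_enough_arrows inv Q0 r0].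
have [n Q0] := search_terminates q s rule.
exists n; split=> // v.
exact: final_remaining0 (invariant_search q s rule n) Q0 v conn enough.
Qed.
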